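(* Let $D$ be a connected, reduced, checkerboard-colored link diagram with at least one crossing and with associated Tait graph $G$, and let $\sigma$ be a state of $D$. Let $E_{\sigma}\subseteq E(G)$ be the edge subset determined by $\sigma$, namely the union of the $+$ edges whose crossings are A-resolved by $\sigma$ and the $-$ edges whose crossings are B-resolved by $\sigma$, and let $\overline{E_{\sigma}}=E(G)-E_{\sigma}$. Then $D$ is homogeneously adequate with respect to $\sigma$ if and only if the partition $E(G)=E_{\sigma}\sqcup\overline{E_{\sigma}}$ satisfies the following conditions. (1) Every edge of $E_{\sigma}$ is contained in a cycle of $G|E_{\sigma}$. (2) No edge of $\overline{E_{\sigma}}$ has both of its endpoints on a single connected component of $G|E_{\sigma}$. (3) Each connected component of $G|E_{\sigma}$ either consists entirely of $+$ edges or consists entirely of $-$ edges. (4) For each fundamental cycle of $G|E_{\sigma}$, the edges of $\overline{E_{\sigma}}$ inside that fundamental cycle either consist entirely of $+$ edges or consist entirely of $-$ edges. (5) The edges of $\overline{E_{\sigma}}$ in the unbounded region outside all of the fundamental cycles of $G|E_{\sigma}$ either consist entirely of $+$ edges or consist entirely of $-$ edges.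
   Context: A link diagram $D\subseteq\mathbb{R}^2$ has a projection graph $\Gamma_D$, obtained by replacing crossings with 4-valent vertices; $D$ is connected if $\Gamma_D$ is connected, and the regions of $D$ are the complementary regions of $\Gamma_D$. $D$ is reduced if it has no nugatory crossing, i.e. no crossing that meets a region of $D$ more than once. $D$ is checkerboard-colored if each region is shaded black or white so that near each crossing two opposite regions are black and the other two opposite regions are white. States. At each crossing one may perform the A-resolution (the smoothing joining the two regions swept out when the over-strand is rotated counterclockwise toward the under-strand) or the B-resolution (the other smoothing). A state $\sigma$ of $D$ is a choice of A- or B-resolution at each crossing. Resolving all crossings according to $\sigma$ gives the state graph $H_\sigma$, consisting of disjoint state circles together with one state segment (an A-segment or a B-segment according to the resolution) per crossing. $D$ is $\sigma$-adequate with respect to $\sigma$ if no state segment of $H_\sigma$ connects a state circle to itself. $D$ is $\sigma$-homogeneous with respect to $\sigma$ if no complementary region in $\mathbb{R}^2$ of the union of the state circles of $H_\sigma$ contains both A-segments and B-segments. $D$ is homogeneously adequate with respect to $\sigma$ if it is both $\sigma$-adequate and $\sigma$-homogeneous with respect to $\sigma$. Tait graph. The Tait graph $G$ of a checkerboard-colored diagram $D$ is the plane multigraph with one vertex (placed in the region) per black region and one edge (passing through the crossing) per crossing, joining the vertices of the two black regions meeting at that crossing. Its edges are signed: an edge is $+$ if the A-resolution of its crossing locally joins the two black regions (so the B-resolution separates them), and $-$ if the B-resolution locally joins the two black regions (so the A-resolution separates them). For $H\subseteq E(G)$, $G|H$ is the spanning subgraph of $G$ with all the vertices of $G$ and edge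 set $H$, with the plane embedding inherited from $G$. Cycles may have length two. A fundamental cycle of a plane graph is the boundary of a face (complementary region) of it; the edges of $\overline{E_\sigma}$ inside a fundamental cycle of $G|E_\sigma$ are those lying in the corresponding bounded face of $G|E_\sigma$, and the unbounded region outside all the fundamental cycles is the unbounded face of $G|E_\sigma$. *)

(* Defs.v *)
From mathcomp Require Import all_boot.

Set Implicit Arguments.
Unset Strict Implicit.
Unset Printing Implicit Defensive.

(** Graphs drawn in the oriented plane are encoded as combinatorial maps.  A
    dart is an edge together with one of its ends, pointing away from that
    end; [edge] reverses a dart and [node] sends a dart to the next one
    counterclockwise around its vertex.  Vertices, edges and (for a connected
    graph) faces are the orbits of [node], [edge] and [face].  Every vertex
    meets an edge. *)
Record cmap := Cmap {
  dart : finType;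
  edge : dart -> dart;
  node : dart -> dart;
  edgeK : involutive edge;
  edge_neq : forall x, edge x != x;
  node_inj : injective node
}.

Section Cmap.
Variable G : cmap.
Implicit Types (x y : dart G) (H : {set dart G}).

(** A dart [x] also stands for the corner between [x] and [node x], on the
    left of [x].  [face] goes to the next corner of the region on the left
    of [x], counterclockwise as seen from inside that region. *)
Definition face x : dart G := finv (@node G) (edge x).

Definition glink : rel (dart G) := fun x y => (y == edge x) || (y == node x).

Definition cmap_connected : Prop := forall x y, connect glink x y.

(** Euler's formula: every component has genus 0. *)
Definition planar : Prop :=
  fcard (@node G) predT + fcard face predT
  = fcard (@edge G) predT + (n_comp glink predT).*2.

(** A set of edges of [G] is given by a set [H] of darts closed under [edge];
    [G|H] has all the vertices of [G] and the edges in [H]. *)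

(** The vertices of [x] and [y] lie on one component of [G|H]. *)
Definition component_in H : rel (dart G) :=
  connect (fun x y => (y == node x) || (x \in H) && (y == edge x)).

(** For connected [G]: a complementary region of [G|H] is made of faces of
    [G] together with the open edges outside [H], each of which merges the
    faces on its two sides.  [face_in H x y] says that the faces of [G] on the
    left of [x] and of [y] lie in one complementary region of [G|H]; an edge
    [x] outside [H] lies in the region of [x]. *)
Definition face_in H : rel (dart G) :=
  connect (fun x y => (y == face x) || (x \notin H) && (y == edge x)).

(** A cycle of [G|H], as a cyclic sequence of darts traversing its edges:
    neither vertices nor edges are repeated. *)
Definition cycle_in H (c : seq (dart G)) : bool :=
  [&& c != [::], all (mem H) c,
      cycle (fun x y => fconnect (@node G) (edge x) y) c,
      uniq [seq froot (@node G) x | x <- c]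
    & uniq [seq froot (@edge G) x | x <- c]].

End Cmap.

(** A link diagram is its projection graph, a planar 4-valent map, together
    with the over-strand of each crossing ([over x]: the dart [x] belongs to
    the over-strand) and the unbounded region ([unbounded x]: the corner [x]
    lies in the unbounded region).  Crossings are the orbits of [node].
    Crossingless circles are not encoded, as a connected diagram with a
    crossing has none. *)
Record link_diagram := LinkDiagram {
  proj :> cmap;
  proj_planar : planar proj;
  node_order : forall x : dart proj, order (@node proj) x = 4;
  over : dart proj -> bool;
  over_node : forall x, over (node x) = ~~ over x;
  unbounded : dart proj -> bool;
  unbounded_ex : forall x : dart proj, exists y, unbounded y;
  (* the unbounded region meets a component of the projection graph in at
     most one face of that component *)
  unbounded_face : forall x y, unbounded x -> connect (@glink proj) x y ->
    unbounded y = fconnect (@face proj) x y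
}.

Definition n_crossings (D : link_diagram) : nat := fcard (@node D) predT.

Definition diagram_connected (D : link_diagram) : Prop := cmap_connected D.

(** For connected [D], the regions of [D] are the orbits of [face]. *)
Definition same_region (D : link_diagram) : rel (dart D) := fconnect (@face D).

(** The crossing of [x] has two corners in one region. *)
Definition nugatory (D : link_diagram) (x : dart D) : Prop :=
  exists y z, [/\ fconnect (@node D) x y, fconnect (@node D) x z, y != z
                & same_region y z].

Definition reduced (D : link_diagram) : Prop := forall x : dart D, ~ nugatory x.

(** Opposite dart, or opposite corner, at the same crossing. *)
Definition opposite (D : link_diagram) (x : dart D) : dart D := node (node x).

Variant resolution := Ares | Bres.

(** The resolution [r] joins the region at corner [x] to the one at corner
    [opposite x].  Rotating an over-strand dart [x] counterclockwise to the next
    (under-strand) dart [node x] sweeps out the corner [x]. *)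
Definition joins (D : link_diagram) (r : resolution) (x : dart D) : bool :=
  if r is Ares then over x else ~~ over x.

Record state (D : link_diagram) := State {
  res :> dart D -> resolution;
  res_node : forall x, res (node x) = res x
}.

Section State.
Variables (D : link_diagram) (s : state D).
Implicit Types x y : dart D.

(** After resolution, an arc cuts off each corner [x] that is not joined to
    its opposite, connecting the darts [x] and [node x].  [state_arc x] is the
    other end of the arc starting at [x]. *)
Definition state_arc x : dart D :=
  if joins (s x) x then finv (@node D) x else node x.

Definition same_circle : rel (dart D) :=
  connect (fun x y => (y == edge x) || (y == state_arc x)).

(** The two arcs at the crossing of [x] start at [x] and at [opposite x]; the
    state segment connects them. *)
Definition adequate : Prop := forall x, ~~ same_circle x (opposite x).

(** For connected [D]: the complementary regions of the union of the state
    circles are obtained from the regions of [D] by joining opposite corners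
    according to [s].  The state segment of the crossing of [x] lies in the
    complementary region of [x] when the corner [x] is joined to [opposite x]. *)
Definition same_state_region : rel (dart D) :=
  connect (fun x y => (y == face x) || joins (s x) x && (y == opposite x)).

Definition homogeneous : Prop :=
  ~ exists x y, [/\ joins (s x) x, joins (s y) y, same_state_region x y,
                    s x = Ares & s y = Bres].

Definition homogeneously_adequate : Prop := adequate /\ homogeneous.

End State.

Record coloring (D : link_diagram) := Coloring {
  black :> dart D -> bool;
  black_face : forall x, black (face x) = black x;
  black_node : forall x, black (node x) = ~~ black x
}.

Section Tait.
Variables (D : link_diagram) (b : coloring D).

(** An end of the Tait edge through a crossing is a black corner of that
    crossing.  The other end is the opposite corner, and the ends at a black
    region are ordered as the corners around that region. *)
Definition tdart : finType := {x : dart D | b x}.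

Fact opposite_black (x : tdart) : b (opposite (val x)).
Proof. by rewrite /opposite !black_node negbK (valP x). Qed.

Fact face_black (x : tdart) : b (face (val x)).
Proof. by rewrite black_face (valP x). Qed.

Definition tedge (x : tdart) : tdart := Sub (opposite (val x)) (opposite_black x).
Definition tnode (x : tdart) : tdart := Sub (face (val x)) (face_black x).

Fact tedgeK : involutive tedge.
Proof.
move=> x; apply: val_inj => /=.
by have := iter_order (@node_inj D) (val x); rewrite node_order.
Qed.

Fact tedge_neq x : tedge x != x.
Proof.
apply/eqP => /(congr1 val) /= opposite_x.
have := orbit_uniq (@node D) (val x); rewrite /orbit node_order /=.
by rewrite -[node (node (val x))]/(opposite (val x)) opposite_x !inE eqxx orbT.
Qed.

Fact tnode_inj : injective tnode.
Proof.
move=> x y /(congr1 val) /= /(congr1 (@node D)).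
by rewrite /face !(f_finv (@node_inj D)) => /(can_inj (@edgeK D)) /val_inj.
Qed.

Definition tait : cmap := Cmap tedgeK tedge_neq tnode_inj.

Definition positive (x : dart tait) : bool := joins Ares (val x).

(** The left side of the Tait dart [x] at its crossing is the white corner
    that precedes the black corner [val x] counterclockwise; so the face of the
    Tait graph on the left of [x] is the one containing that white region.
    [tait_unbounded x]: the face on the left of [x] may be the unbounded one.
    If the unbounded region of [D] is white, that is the face containing it.
    If it is black, the Tait graph has a vertex [v] in it, and according to how
    the edges at [v] are drawn, the unbounded face is the face at any one of
    the corners of [v]. *)
Definition tait_unbounded (x : dart tait) : bool :=
  unbounded (finv (@node D) (val x)) || unbounded (val x).

Definition E_state (s : state D) : {set dart tait} :=
  [set x | if s (val x) is Ares then positive x else ~~ positive x].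

End Tait.

(* Main.v *)
Require Import Defs.
From mathcomp Require Import all_boot zify.

Set Implicit Arguments.
Unset Strict Implicit.
Unset Printing Implicit Defensive.

(** Resolving the crossings of [D] glues its regions: each crossing links either
    its two black corners or its two white ones.  On the black side the linked
    regions are the components of [G|E], on the white side they are the
    complementary regions of [G|E], since the faces of [G] are the white regions
    of [D].  Hence the regions of the union of the state circles are these
    components and these complementary regions together, and homogeneity is the
    conjunction of conditions (3), (4) and (5) ([homogeneousP]).

    Adequacy is decided one crossing at a time.  Let the crossing of [e] be in
    [E].  If its link is a bridge of the black gluing, a circle that passes the
    crossing along one arc crosses over to the other side of the bridge and can
    only come back along the other arc, so one circle contains both arcs
    ([bridge_circle]).  If both arcs are on one circle, that circle follows one
    white region, so the two white corners of the crossing are in one region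
    ([circle_region]).  In the plane this makes the black link a bridge
    ([planar_duality]), which closes the loop: the crossing is adequate exactly
    when [e] is not a bridge of [G|E], that is, when [e] lies on a cycle
    ([on_cycleP]).  For [e] outside [E] the same argument with the colors
    exchanged says that the crossing is adequate exactly when the ends of [e] are
    in different components of [G|E].  So adequacy is the conjunction of (1) and
    (2) ([adequateP]).

    Planar duality is the only place where planarity enters.  The two steps that
    hold in every genus show that when a link moves from white to black at a
    crossing, merging two black regions excludes splitting a white one.  Moving
    the links one by one from all white to all black, the merges and the
    splittings are therefore at most as many as the crossings, while Euler's
    formula says that they are exactly as many.  So each move does exactly one of
    the two, and any given move is part of such a sequence. *)

(** * Connectivity of finite relations *)

(** The common shape of the relations that generate components, regions and
    circles: follow the permutation [f], or jump by [g] where [P] allows it. *)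
Definition link_rel (T : finType) (f g : T -> T) (P : pred T) : rel T :=
  fun x y => (y == f x) || P x && (y == g x).

Section Links.
Variable T : finType.
Implicit Types (e : rel T) (f g : T -> T) (P a : pred T).

Lemma connect_symI e : (forall x y, e x y -> connect e y x) -> connect_sym e.
Proof.
move=> e_rev.
suff half x y : connect e x y -> connect e y x.
  by move=> x y; apply/idP/idP => /half.
case/connectP=> p; elim: p x => [|z p IHp] x /=; first by move=> _ ->.
by case/andP=> /e_rev zx /IHp h /h /connect_trans; apply.
Qed.

Lemma link_rel_sym f g P :
  injective f -> involutive g -> (forall x, P (g x) = P x) ->
  connect_sym (link_rel f g P).
Proof.
move=> f_inj gK Pg; apply: connect_symI => x y /orP[/eqP-> | /andP[Px /eqP->]].
  apply: (connect_sub (e := frel f)).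
    by move=> u v /eqP <-; apply: connect1; rewrite /link_rel eqxx.
  by rewrite fconnect_sym // fconnect1.
by apply: connect1; rewrite /link_rel Pg Px gK eqxx orbT.
Qed.

Lemma connect_homo (T' : finType) (e : rel T) (e' : rel T') (h : T -> T') :
  (forall x y, e x y -> connect e' (h x) (h y)) ->
  forall x y, connect e x y -> connect e' (h x) (h y).
Proof.
move=> he x y /connectP[p]; elim: p x => [|z p IHp] x /=; first by move=> _ ->.
by case/andP=> /he xz /IHp h' /h'; apply: connect_trans.
Qed.

Lemma connect_invariant (A : eqType) e (k : T -> A) :
  (forall x y, e x y -> k x = k y) -> forall x y, connect e x y -> k x = k y.
Proof.
move=> ke x y /connectP[p]; elim: p x => [|z p IHp] x /=; first by move=> _ ->.
by case/andP=> /ke -> /IHp h /h.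
Qed.

(** An injection commuting with both maps identifies its domain with a union
    of classes of the target. *)
Lemma connect_link_embed (T' : finType) (h : T -> T') f g P
    (f' g' : T' -> T') (P' : pred T') :
  injective h -> (forall x, f' (h x) = h (f x)) ->
  (forall x, g' (h x) = h (g x)) -> (forall x, P' (h x) = P x) ->
  forall x y, connect (link_rel f' g' P') (h x) (h y)
              = connect (link_rel f g P) x y.
Proof.
move=> h_inj hf hg hP x y; apply/idP/idP; last first.
  apply: connect_homo => u v /orP[/eqP-> | /andP[Pu /eqP->]]; apply: connect1.
    by rewrite /link_rel hf eqxx.
  by rewrite /link_rel hP hg Pu eqxx orbT.
case/connectP=> p; elim: p x => [|z p IHp] x /=.
  by move=> _ /h_inj ->; apply: connect0.
case/andP=> xz z_p last_p.
have [v zv xv] : exists2 v, z = h v & link_rel f g P x v.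
  case/orP: xz => [/eqP-> | /andP[]].
    by exists (f x); rewrite ?hf // /link_rel eqxx.
  rewrite hP => Px /eqP->.
  by exists (g x); rewrite ?hg // /link_rel Px eqxx orbT.
apply: connect_trans (connect1 xv) _.
by apply: IHp; rewrite -zv.
Qed.

(** One new link merges at most two classes, and merges none when its ends
    were already connected.  Only the classes in [a] are counted, and [e] may
    have further steps there. *)
Lemma n_comp_link e e' a x y :
  connect_sym e -> connect_sym e' -> closed e' a ->
  (forall u v, u \in a -> e' u v ->
     [|| connect e u v, (u == x) && (v == y) | (u == y) && (v == x)]) ->
  n_comp e a <= n_comp e' a + ~~ connect e x y.
Proof.
move=> se se' cl_a ee'.
(* [h] names the class obtained by merging the class of [y] into that of [x] *)
pose h u := if root e u == root e y then root e x else root e u.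
have h_inv u v : u \in a -> connect e' u v -> h u = h v.
  move=> ua /connectP[p]; elim: p u ua => [|z p IHp] u ua /=.
    by move=> _ ->.
  case/andP=> uz z_p last_p; rewrite -(IHp z) //; last by rewrite -(cl_a _ _ uz).
  case/or3P: (ee' _ _ ua uz) => [/(rootP se) | /andP[/eqP-> /eqP->]
                                | /andP[/eqP-> /eqP->]]; rewrite /h.
  - by move=> ->.
  - by rewrite eqxx; case: ifP.
  - by rewrite eqxx; case: ifP.
pose S := [pred u | (roots e u && (u \in a)) &&
                    (connect e x y || (u != root e y))].
have hS u : u \in S -> h u = u.
  case/andP=> /andP[/eqP ru _] /orP[xy | uy]; rewrite /h ru.
    by case: eqP => // ->; apply/(rootP se).
  by rewrite (negPf uy).
have le_S : #|S| <= n_comp e' a.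
  rewrite -(card_in_imset (f := root e') (D := S)).
    apply: subset_leq_card.
    apply/subsetP => _ /imsetP[u /andP[/andP[_ ua] _] ->]; rewrite inE /= roots_root //=.
    by rewrite -(closed_connect cl_a (connect_root e' u)).
  move=> u v uS vS /(rootP se') /h_inv huv.
  by rewrite -(hS u) // -(hS v) // huv //; case/andP: uS => /andP[].
apply: leq_trans (_ : #|S| + ~~ connect e x y <= _); last by rewrite leq_add2r.
case xy: (connect e x y); rewrite ?addn0 ?addn1 /=.
  by apply: subset_leq_card; apply/subsetP => u; rewrite !inE xy andbT.
rewrite /n_comp_mem (cardD1 (root e y)) addnC -addn1.
apply: leq_add; last by case: (_ \in _).
apply: subset_leq_card; apply/subsetP => u; rewrite !inE xy /=.
by case/andP=> -> ->.
Qed.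

Lemma n_comp_sub e e' a :
  connect_sym e -> connect_sym e' -> closed e' a ->
  (forall u v, u \in a -> e' u v -> connect e u v) ->
  n_comp e a <= n_comp e' a.
Proof.
move=> se se' cl_a ee'; case: (pickP a) => [x _ | a0].
  have := @n_comp_link e e' a x x se se' cl_a; rewrite connect0 addn0.
  by apply=> u v ua /(ee' _ _ ua) ->.
by rewrite /n_comp_mem eq_card0 // => u; rewrite inE /= [u \in a]a0 andbF.
Qed.

Lemma n_comp_le1 e a :
  connect_sym e -> {in a &, forall x y, connect e x y} -> n_comp e a <= 1.
Proof.
move=> se all_a; apply/card_le1_eqP => u v /andP[/eqP ru ua] /andP[/eqP rv va].
by rewrite -ru -rv; apply/esym/(rootP se); apply: all_a.
Qed.

Lemma order_involution f x : involutive f -> f x != x -> order f x = 2.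
Proof.
move=> fK fx; apply: (@order_cycle _ f [:: x; f x]).
- by rewrite /= fK !eqxx.
- by rewrite /= inE eq_sym fx.
- by rewrite inE eqxx.
Qed.

Lemma fcard_involution f a :
  involutive f -> (forall x, f x != x) -> fclosed f a -> fcard f a * 2 = #|a|.
Proof.
move=> fK f_neq cl_a; apply: (fcard_order_set (inv_inj fK)) => //.
by apply/subsetP => x _; rewrite inE order_involution.
Qed.

End Links.

(** * Cycles and bridges *)

Section Cycles.
Variables (G : cmap) (H : {set dart G}) (e : dart G).
Hypotheses (H_edge : forall x, (edge x \in H) = (x \in H)) (eH : e \in H).
Implicit Types x y v w : dart G.

Let rootn := froot (@node G).
Let roote := froot (@edge G).
Let edge_inj : injective (@edge G) := inv_inj (@edgeK G).

Let same_vertex x y : (rootn x == rootn y) = fconnect (@node G) x y.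
Proof. exact: (root_connect (fconnect_sym (@node_inj G))). Qed.

Lemma same_edgeE x y : (roote x == roote y) = (y == x) || (y == edge x).
Proof.
rewrite (root_connect (fconnect_sym edge_inj)) fconnect_orbit /orbit.
by rewrite order_involution ?edge_neq //= ?inE //; apply: edgeK.
Qed.

Let H' := H :\ e :\ edge e.

Let in_H' x : (x \in H') = (x \in H) && (roote e != roote x).
Proof.
rewrite same_edgeE !inE negb_or.
by case: (x == e); case: (x == edge e); case: (x \in H).
Qed.

Let H'_edge x : (edge x \in H') = (x \in H').
Proof.
rewrite !in_H' H_edge; congr (_ && ~~ (_ == _)).
by apply/(rootP (fconnect_sym edge_inj)); rewrite -same_fconnect1.
Qed.

Let component_in_sym : symmetric (component_in H').
Proof. exact: (link_rel_sym (@node_inj G) (@edgeK G) H'_edge). Qed.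

Let component_vertex x y : rootn x = rootn y -> component_in H' x y.
Proof.
move=> /eqP; rewrite same_vertex; apply: connect_sub => u v /eqP <-.
by apply: connect1; rewrite eqxx.
Qed.

Let step v w :=
  [exists d, [&& d \in H', rootn d == v & rootn (edge d) == w]].

Lemma component_steps x y :
  component_in H' x y -> connect step (rootn x) (rootn y).
Proof.
apply: connect_homo => u v /orP[/eqP-> | /andP[uH /eqP->]].
  suff -> : rootn (node u) = rootn u by apply: connect0.
  by apply/eqP; rewrite eq_sym same_vertex fconnect1.
by apply: connect1; apply/existsP; exists u; rewrite uH !eqxx.
Qed.

(** A path without repeated vertices lifts to darts.  It repeats no edge
    either: an edge met again would bring back the first end of its first
    occurrence. *)
Lemma simple_path_darts v p :
  path step v p -> uniq (v :: p) ->
  exists ds, [/\ all (mem H') ds, [seq rootn d | d <- ds] = belast v p,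
                 [seq rootn (edge d) | d <- ds] = p
               & uniq [seq roote d | d <- ds]].
Proof.
elim: p v => [|w p IHp] v /=; first by exists [::].
case/andP=> /existsP[d /and3P[dH /eqP dv /eqP dw]] w_p /andP[vp up].
have [ds [dsH ds1 ds2 dsU]] := IHp w w_p up.
exists (d :: ds); rewrite /= dH dv dw ds1 ds2; split=> //.
rewrite dsU andbT; apply: contra vp => /mapP[d' d'_ds /eqP].
rewrite same_edgeE => /orP[] /eqP d'd.
  by apply: mem_belast; rewrite -ds1 -dv -d'd; apply: map_f.
rewrite inE -ds2 -dv; apply/orP; right; rewrite -(edgeK d) -d'd.
exact: (map_f (fun d => rootn (edge d)) d'_ds).
Qed.

Let path_map_shift (A : eqType) (h k : dart G -> A) x ds z :
  [seq k d | d <- rcons ds z] = [seq h d | d <- x :: ds] ->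
  path (fun u v => h u == k v) x (rcons ds z).
Proof.
elim: ds x => [|d ds IHds] x /=; first by case=> ->; rewrite eqxx.
by case=> -> /= eq_ds; rewrite eqxx /=; apply: IHds.
Qed.

(** An edge of [H] lies on a cycle exactly when it is not a bridge: the rest of
    the cycle connects its ends, and conversely a path without repeated vertices
    between its ends closes up to a simple cycle. *)
Lemma on_cycleP :
  (exists2 c, cycle_in H c & (e \in c) || (edge e \in c)) <->
  component_in H' e (edge e).
Proof.
split=> [[c /and5P[_ c_H c_cyc _ c_edges] ec] | conn_e].
  have [d de dc] : exists2 d, (d == e) || (d == edge e) & d \in c.
    by case/orP: ec; [exists e | exists (edge e)]; rewrite ?eqxx ?orbT.
  suff conn_d : component_in H' (edge d) d.
    by case/orP: de conn_d => /eqP->; rewrite ?edgeK // component_in_sym.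
  have [i p def_p] := rot_to dc.
  move: c_cyc; rewrite -(rot_cycle i) def_p /=.
  have: all (mem H) (d :: p) by rewrite -def_p; rewrite (eq_all_r (mem_rot i c)).
  move=> /= /andP[_ pH].
  have : uniq [seq roote x | x <- d :: p] by rewrite -def_p map_rot rot_uniq.
  rewrite /= => /andP[dp _].
  have pH' x : x \in p -> x \in H'.
    move=> xp; rewrite in_H' [x \in H](allP pH) //=; apply: contra dp => /eqP ex.
    have -> : roote d = roote e.
      by apply/esym/eqP; rewrite same_edgeE.
    by rewrite ex; apply: map_f.
  (* walk along the rest of the cycle, from the far end of [d] back to [d] *)
  have walk x : path (fun x y => fconnect (@node G) (edge x) y) x (rcons p d) ->
      component_in H' (edge x) d.
    elim: p pH' {def_p pH dp} x => [|y p IHp] pH' x /=.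
      by rewrite andbT -same_vertex => /eqP /component_vertex.
    case/andP; rewrite -same_vertex => /eqP /component_vertex xy y_p.
    apply: connect_trans xy _; apply: connect_trans (IHp _ y y_p).
      by apply: connect1; rewrite (pH' y) ?mem_head // eqxx orbT.
    by move=> z zp; apply: pH'; rewrite inE zp orbT.
  exact: walk.
have /component_steps/connectP[p0 p0_path p0_last] : component_in H' (edge e) e.
  by rewrite component_in_sym.
case/shortenP: p0_path p0_last => p p_path p_uniq _ p_last {p0}.
have [ds [dsH ds1 ds2 dsU]] := simple_path_darts p_path p_uniq.
have ds_roots : [seq rootn d | d <- rcons ds e]
              = [seq rootn (edge d) | d <- e :: ds].
  by rewrite map_rcons ds1 /= ds2 p_last -lastI.
exists (e :: ds); last by rewrite mem_head.
apply/and5P; split=> //.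
- rewrite /= eH; apply/allP => d /(allP dsH) /=.
  by rewrite in_H' => /andP[].
- rewrite /=; have := path_map_shift ds_roots.
  by rewrite (eq_path (e' := fun x y => fconnect (@node G) (edge x) y)).
- by rewrite /= -rcons_uniq -map_rcons ds_roots /= ds2.
- rewrite /= dsU andbT; apply/mapP => -[d d_ds e_d].
  by have := allP dsH d d_ds; rewrite /= in_H' => /andP[_ /eqP].
Qed.

End Cycles.

(** * Circles and regions of a smoothing *)

Section Smoothing.
Variables (D : link_diagram) (b : coloring D).
Implicit Types (x y z : dart D) (J K : pred (dart D)).

Lemma oppositeK : involutive (@opposite D).
Proof. by move=> x; have := iter_order (@node_inj D) x; rewrite node_order. Qed.

Lemma finv_node x : finv (@node D) x = opposite (node x).
Proof. by rewrite /finv node_order. Qed.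

Lemma faceE x : face x = opposite (node (edge x)).
Proof. exact: finv_node. Qed.

Lemma edge_inj : injective (@edge D).
Proof. exact: inv_inj (@edgeK D). Qed.

Lemma face_inj : injective (@face D).
Proof. by move=> x y /(finv_inj (@node_inj D)) /edge_inj. Qed.

Lemma crossingE x y :
  fconnect (@node D) x y = (y \in [:: x; node x; opposite x; opposite (node x)]).
Proof. by rewrite fconnect_orbit /orbit node_order. Qed.

Lemma crossing_uniq x : uniq [:: x; node x; opposite x; opposite (node x)].
Proof. by have := orbit_uniq (@node D) x; rewrite /orbit node_order. Qed.

Lemma crossing_trans x y z :
  fconnect (@node D) y z -> fconnect (@node D) x y = fconnect (@node D) x z.
Proof. by move=> yz; apply: (same_connect_r (fconnect_sym (@node_inj D)) yz). Qed.

Lemma color_opposite x : b (opposite x) = b x.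
Proof. by rewrite /opposite !black_node negbK. Qed.

Lemma color_edge x : b (edge x) = ~~ b x.
Proof. by rewrite -(black_face b x) faceE color_opposite black_node negbK. Qed.

(** [J] selects the corners joined to their opposites. *)
Definition smoothing J := forall x, J (node x) = ~~ J x.

Definition region_link J : rel (dart D) := link_rel (@face D) (@opposite D) J.
Definition region J : rel (dart D) := connect (region_link J).

Definition arc J x := if J x then finv (@node D) x else node x.
Definition circle J : rel (dart D) := connect (link_rel (@edge D) (arc J) predT).

Definition flip x J : pred (dart D) := fun y => J y (+) fconnect (@node D) x y.

Lemma smoothing_opposite J : smoothing J -> forall x, J (opposite x) = J x.
Proof. by move=> smJ x; rewrite /opposite !smJ negbK. Qed.

Lemma flip_smoothing x J : smoothing J -> smoothing (flip x J).
Proof.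
by move=> smJ y; rewrite /flip smJ -(same_fconnect1_r (@node_inj D)) addNb.
Qed.

Lemma flip_self x J : flip x J x = ~~ J x.
Proof. by rewrite /flip connect0 addbT. Qed.

Lemma flipK x J : flip x (flip x J) =1 J.
Proof. by move=> y; rewrite /flip addbK. Qed.

Lemma flip_node x J : flip (node x) J =1 flip x J.
Proof. by move=> y; rewrite /flip -(same_fconnect1 (@node_inj D)). Qed.

Lemma eq_region J K : J =1 K -> region J =2 region K.
Proof.
by move=> JK; apply: eq_connect => u v; rewrite /region_link /link_rel JK.
Qed.

Lemma region_sym J :
  (forall x, J (opposite x) = J x) -> connect_sym (region_link J).
Proof. exact: (link_rel_sym face_inj oppositeK). Qed.

Lemma region_color J x y : region J x y -> b x = b y.
Proof.
apply: connect_invariant => u v /orP[/eqP-> | /andP[_ /eqP->]].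
  by rewrite black_face.
by rewrite color_opposite.
Qed.

Lemma region_face J x : region J x (face x).
Proof. by apply: connect1; rewrite /region_link /link_rel eqxx. Qed.

Lemma region_opposite J x : J x -> region J x (opposite x).
Proof.
by move=> Jx; apply: connect1; rewrite /region_link /link_rel Jx eqxx orbT.
Qed.

(** A dart borders two corners of its crossing, one of each color; this is the
    one of color [c]. *)
Definition side (c : bool) y := if b y == c then y else finv (@node D) y.

Section Side.
Variables (K : pred (dart D)) (c : bool).
Hypothesis K_opp : forall x, K (opposite x) = K x.

Lemma side_edge y : region K (side c y) (side c (edge y)).
Proof.
rewrite /side color_edge; case: (b y =P c) => [->|byc].
  have -> : (~~ c == c) = false by case: c.
  exact: region_face.
have -> : ~~ b y == c by case: (b y) c byc => -[].
rewrite -[in finv _ y](edgeK y) -/(face (edge y)).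
by rewrite /region (region_sym K_opp); apply: region_face.
Qed.

Lemma side_node y : (b (node y) == c -> K (node y)) ->
  region K (side c y) (side c (node y)).
Proof.
move=> Kny; rewrite /side finv_f; last exact: node_inj.
case: (b (node y) =P c) Kny => [bny /(_ isT) Kny | bny _].
  have -> : (b y == c) = false by rewrite -bny black_node; case: (b y).
  rewrite finv_node /region (region_sym K_opp); exact: region_opposite.
have -> : b y == c by move: bny; rewrite black_node; case: (b y) c => -[].
exact: connect0.
Qed.

Lemma side_arc J y : smoothing J ->
  (forall z, fconnect (@node D) y z -> K z = J z) ->
  region K (side c y) (side c (arc J y)).
Proof.
move=> smJ KJ; rewrite /arc; case Jy: (J y); last first.
  by apply: side_node => _; rewrite KJ ?fconnect1 // smJ Jy.
rewrite -{1}(f_finv (@node_inj D) y) /region (region_sym K_opp).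
by apply: side_node => _; rewrite f_finv ?KJ //; apply: node_inj.
Qed.

End Side.

Section Arcs.
Variable J : pred (dart D).
Hypothesis smJ : smoothing J.

Lemma finv_unjoined y : J (finv (@node D) y) = ~~ J y.
Proof. by rewrite -{2}(f_finv (@node_inj D) y) smJ negbK. Qed.

Lemma arcK : involutive (arc J).
Proof.
move=> y; rewrite {2}/arc; case Jy: (J y); rewrite /arc.
  by rewrite finv_unjoined Jy f_finv //; apply: node_inj.
by rewrite smJ Jy finv_f //; apply: node_inj.
Qed.

Lemma arc_neq y : arc J y != y.
Proof.
by apply/eqP => /(congr1 b); rewrite /arc; case: ifP => _;
  rewrite ?finv_node ?color_opposite black_node; case: (b y).
Qed.

Lemma circle_sym : connect_sym (link_rel (@edge D) (arc J) predT).
Proof. by apply: link_rel_sym => //; [apply: edge_inj | apply: arcK]. Qed.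

Lemma circle_arc y : circle J y (arc J y).
Proof. by apply: connect1; rewrite /link_rel eqxx orbT. Qed.

Lemma circle_edge y : circle J y (edge y).
Proof. by apply: connect1; rewrite /link_rel eqxx. Qed.

Lemma circle_r z x y : circle J x y -> circle J z x = circle J z y.
Proof. by move=> xy; apply: (same_connect_r circle_sym xy). Qed.

(** A circle follows, on its side of color [c], a single region. *)
Lemma circle_side c x y : circle J x y -> region J (side c x) (side c y).
Proof.
apply: connect_homo => u v /orP[/eqP-> | /andP[_ /eqP->]].
  exact: side_edge (smoothing_opposite smJ) _.
by apply: side_arc => //; apply: smoothing_opposite.
Qed.

(** Both sides say that the two arcs at the crossing lie on one circle: [x] and
    its opposite are on different arcs, and so are the two other darts. *)
Lemma circle_opposite_node x :
  circle J (node x) (opposite (node x)) = circle J x (opposite x).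
Proof.
have arcs y : ~~ J y -> circle J (node y) (opposite (node y)) =
                        circle J y (opposite y).
  move=> /negPf Jy; have Joy := smoothing_opposite smJ y.
  have ny := circle_arc y; rewrite /arc Jy in ny.
  have noy := circle_arc (opposite y); rewrite /arc Joy Jy in noy.
  apply/esym/(etrans (same_connect circle_sym ny _)).
  exact: circle_r noy.
case Jx: (J x); last by apply: arcs; rewrite Jx.
rewrite -arcs; last by rewrite smJ Jx.
by rewrite -[node (node x)]/(opposite x) oppositeK; apply: circle_sym.
Qed.

(** A circle containing both arcs at the crossing runs along one region of the
    color of [node x], and passes both corners of that color. *)
Lemma circle_region x :
  circle J x (opposite x) -> region J (node x) (opposite (node x)).
Proof.
move=> /(circle_side (~~ b x)); rewrite /side color_opposite.
have -> : (b x == ~~ b x) = false by case: (b x).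
rewrite !finv_node -[node (opposite x)]/(opposite (node x)) oppositeK.
by rewrite /region region_sym //; apply: smoothing_opposite.
Qed.

(** If undoing the link at [x] disconnects [x] from the opposite corner, the
    circle through one arc at [x] runs along the region of [x] on one side of
    that arc and along the region of the opposite corner on the other side.
    To close up, it must change regions again, which only the second arc
    allows.  Formally, the darts of the circle that border the region of [x]
    would otherwise be paired by [edge], and paired by [arc J] with one
    exception. *)
Lemma bridge_circle x : J x -> ~~ region (flip x J) x (opposite x) ->
  circle J x (opposite x).
Proof.
move=> Jx cut; have K_opp := smoothing_opposite (flip_smoothing x smJ).
have bnx : (b (node x) == b x) = false by rewrite black_node; case: (b x).
have Jnx : J (node x) = false by rewrite smJ Jx.
have arc_nx : arc J (node x) = opposite x by rewrite /arc Jnx.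
rewrite -arc_nx -(circle_r x (circle_arc (node x))) [circle _ _ _]circle_sym.
apply/negPn/negP => off.
pose P y := region (flip x J) x (side (b x) y).
have P_edge y : P (edge y) = P y.
  rewrite /P; apply/esym; apply: (same_connect_r (region_sym K_opp)).
  exact: side_edge.
have P_arc y : ~~ fconnect (@node D) x y -> P (arc J y) = P y.
  move=> xy; rewrite /P; apply/esym; apply: (same_connect_r (region_sym K_opp)).
  apply: side_arc => // z yz; rewrite /flip -(crossing_trans x yz) (negPf xy).
  by rewrite addbF.
have P_nx : P (node x).
  by rewrite /P /side bnx (finv_f (@node_inj D)); apply: connect0.
have P_ox : ~~ P (opposite x) by rewrite /P /side color_opposite eqxx.
have P_onx : ~~ P (opposite (node x)).
  rewrite /P /side color_opposite bnx.
  rewrite -[finv _ _]/(finv (@node D) (node (opposite x))).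
  by rewrite (finv_f (@node_inj D)).
pose S := [pred y | circle J (node x) y && P y].
have S_nx : node x \in S by rewrite inE P_nx [circle _ _ _]connect0.
have even_S : ~~ odd #|S|.
  rewrite -(fcard_involution (@edgeK D) (@edge_neq D)) ?muln2 ?odd_double //.
  move=> y _ /eqP <-; rewrite !inE P_edge; congr (_ && _).
  exact: circle_r (circle_edge y).
have even_S' : ~~ odd #|[predD1 S & node x]|.
  rewrite -(fcard_involution arcK arc_neq) ?muln2 ?odd_double //.
  apply: intro_closed; first exact: (fconnect_sym (inv_inj arcK)).
  move=> y _ /eqP <-; rewrite !inE => /andP[y_nx /andP[Cy Py]].
  have -> : arc J y != node x.
    apply: contraNneq P_ox => y_nx'.
    by rewrite -arc_nx -y_nx' arcK.
  rewrite -(circle_r _ (circle_arc y)) Cy P_arc //=.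
  rewrite crossingE !inE (negPf y_nx).
  apply/or4P => -[] // /eqP y_x; move: Cy Py; rewrite y_x.
  - by rewrite [circle _ _ _](negPf off).
  - by rewrite (negPf P_ox).
  - by rewrite (negPf P_onx).
by move: even_S; rewrite (cardD1 (node x)) S_nx /= (negPf even_S').
Qed.

End Arcs.

(** * Planar duality *)

(** The number of regions of color [c]: the components of the plane graph
    whose vertices are the faces of color [c] and whose edges are the joined
    crossings of that color. *)
Definition n_regions (c : bool) J := n_comp (region_link J) [pred y | b y == c].

Let color_closed J c : closed (region_link J) [pred y | b y == c].
Proof. by move=> u v /connect1/region_color; rewrite !inE => ->. Qed.

Lemma n_regions_flip J x : smoothing J -> J x ->
  n_regions (b x) (flip x J)
  <= n_regions (b x) J + ~~ region (flip x J) x (opposite x).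
Proof.
move=> smJ Jx; apply: n_comp_link; try apply: color_closed; try apply: region_sym.
- exact: smoothing_opposite (flip_smoothing x smJ).
- exact: smoothing_opposite smJ.
move=> u v; rewrite !inE => /eqP bu /orP[/eqP-> | /andP[Ju /eqP->]].
  by rewrite [connect _ _ _]region_face.
case Fu: (flip x J u); first by rewrite [connect _ _ _]region_opposite.
move: Fu; rewrite /flip Ju /= => /negbFE.
rewrite crossingE !inE => /or4P[] /eqP u_x; move: bu; rewrite u_x.
- by rewrite !eqxx /= orbT.
- by rewrite black_node; case: (b x).
- by rewrite oppositeK !eqxx !orbT.
- by rewrite color_opposite black_node; case: (b x).
Qed.

Lemma n_regions_flip_dual J x : smoothing J -> J x ->
  n_regions (~~ b x) J
  <= n_regions (~~ b x) (flip x J) + ~~ region J (node x) (opposite (node x)).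
Proof.
move=> smJ Jx; have Fnx : flip x J (node x).
  by rewrite (flip_smoothing x smJ) flip_self Jx.
have := n_regions_flip (flip_smoothing x smJ) Fnx; rewrite black_node.
have JK : flip (node x) (flip x J) =1 J by move=> y; rewrite flip_node flipK.
by rewrite /n_regions (eq_n_comp (eq_region JK)) [region _ _ _](eq_region JK).
Qed.

(** When the link at [x] moves from white to black, at most one of the two
    counts changes: if two black regions merge, the black link is a bridge, the
    two arcs at the crossing lie on one circle, and this circle keeps the two
    white corners in one region. *)
Lemma n_regions_step J x : smoothing J -> J x -> b x ->
  n_regions false J + n_regions true (flip x J)
  <= n_regions false (flip x J) + n_regions true J + 1.
Proof.
move=> smJ Jx bx.
have := n_regions_flip smJ Jx; have := n_regions_flip_dual smJ Jx; rewrite bx /=.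
have : region (flip x J) x (opposite x) || region J (node x) (opposite (node x)).
  apply/orP; case cut: (region (flip x J) x (opposite x)); [by left | right].
  by apply: circle_region => //; apply: bridge_circle => //; rewrite cut.
by case/orP=> ->; lia.
Qed.

(** Each crossing where the link moves to black counts twice, once for each of
    its black corners. *)
Definition n_moved I J := #|[pred y | [&& b y, J y & ~~ I y]]|.

Lemma n_moved_flip I J x : smoothing I -> smoothing J -> b x -> J x -> ~~ I x ->
  n_moved I J = n_moved I (flip x J) + 2.
Proof.
move=> smI smJ bx Jx Ix.
have ox : opposite x != x.
  by have := crossing_uniq x; rewrite eq_sym /= !inE !negb_or => /andP[/and3P[]].
rewrite /n_moved (cardD1 x) (cardD1 (opposite x)) !inE /= ox color_opposite bx.
rewrite !smoothing_opposite // Jx Ix /= addnA addnC; congr (_ + _).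
apply: eq_card => y; rewrite !inE /flip crossingE !inE.
case: (y =P opposite x) => [->|yox] /=.
  by rewrite color_opposite bx smoothing_opposite // Jx !orbT.
case: (y =P x) => [->|yx] /=; first by rewrite bx Jx.
case: (b y) / boolP => //= by_; rewrite (_ : (_ == _) || _ = false) ?addbF //.
by apply/negbTE/negP => /orP[] /eqP y_x; move: by_;
  rewrite y_x ?color_opposite black_node bx.
Qed.

Lemma n_regions_chain I J : smoothing I -> smoothing J ->
  (forall y, b y -> I y -> J y) ->
  (n_regions false J + n_regions true I) * 2
  <= (n_regions false I + n_regions true J) * 2 + n_moved I J.
Proof.
move=> smI; have [n] := ubnP (n_moved I J); elim: n J => // n IHn J lt_n smJ IJ.
case: (pickP [pred y | [&& b y, J y & ~~ I y]]) => [x /and3P[bx Jx Ix] | same].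
  have step := n_regions_step smJ Jx bx.
  rewrite (n_moved_flip smI smJ bx Jx Ix) addn2 in lt_n *.
  have IF y : b y -> I y -> flip x J y.
    move=> by_ Iy; rewrite /flip IJ //= crossingE !inE.
    apply/negP => /or4P[] /eqP y_x; move: by_ Iy; rewrite y_x.
    - by rewrite (negPf Ix).
    - by rewrite black_node bx.
    - by rewrite (smoothing_opposite smI) (negPf Ix).
    - by rewrite color_opposite black_node bx.
  have {IHn} := IHn _ (ltnW lt_n) (flip_smoothing x smJ) IF.
  lia.
have JI : J =1 I.
  move=> y; have eqb z : b z -> J z = I z.
    move=> bz; move: (same z) (IJ z bz); rewrite /= bz /=.
    by case: (J z); case: (I z) => // _ ->.
  case by_: (b y); first exact: eqb.
  by apply: negb_inj; rewrite -smI -smJ eqb // black_node by_.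
rewrite /n_regions !(eq_n_comp (eq_region JI)) addnC leq_addr //.
Qed.

Lemma card_black : #|[pred y | b y]| * 2 = #|dart D|.
Proof.
rewrite -(cardC [pred y | b y]) muln2 -addnn; congr (_ + _).
rewrite -(card_image edge_inj); apply: eq_card => y.
by rewrite -{1}[y]edgeK (mem_image edge_inj) !inE color_edge.
Qed.

Hypothesis D_connected : diagram_connected D.

(** Walking along the strands of the diagram, one passes through corners of
    color [c] that are consecutive or opposite; so these are all connected
    once every crossing is joined in color [c]. *)
Lemma region_connected K c : (forall x, K (opposite x) = K x) ->
  (forall x, b x == c -> K x) ->
  {in [pred y | b y == c] &, forall x y, region K x y}.
Proof.
move=> K_opp Kc x y; rewrite !inE => xc yc.
have -> : x = side c x by rewrite /side xc.
have -> : y = side c y by rewrite /side yc.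
apply: connect_homo (D_connected x y) => u v /orP[] /eqP->.
  exact: side_edge.
by apply: side_node => // /Kc.
Qed.

(** Euler's formula, doubled.  A 4-valent map has twice as many edges as
    vertices, so the number of faces exceeds the number of vertices by two;
    and each vertex has two black corners. *)
Lemma euler (x : dart D) : 2 * fcard (@face D) predT >= 4 + #|[pred y | b y]|.
Proof.
have n1 : 0 < n_comp (@glink D) predT.
  apply/card_gt0P; exists (root (@glink D) x); rewrite !inE andbT roots_root //.
  by apply: connect_symI => u v _; apply: D_connected.
have V : fcard (@node D) predT * 4 = #|dart D|.
  apply: (fcard_order_set (@node_inj D)) => //.
  by apply/subsetP => y _; rewrite inE node_order.
have E : fcard (@edge D) predT * 2 = #|dart D|.
  by apply: fcard_involution => //; [apply: edgeK | apply: edge_neq].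
have := proj_planar D; rewrite /planar -muln2; have := card_black; lia.
Qed.

Let white : pred (dart D) := fun x => ~~ b x.

Let black_smoothing : smoothing b. Proof. exact: black_node. Qed.
Let white_smoothing : smoothing white.
Proof. by move=> x; rewrite /white black_node. Qed.

(** A region of a color without links is a single face. *)
Lemma faces_le_regions :
  fcard (@face D) predT <= n_regions true white + n_regions false b.
Proof.
have sub c J : smoothing J -> (forall x, b x == c -> ~~ J x) ->
    fcard (@face D) [pred y | b y == c] <= n_regions c J.
  move=> smJ Jc; apply: n_comp_sub.
  - exact: (fconnect_sym face_inj).
  - exact: region_sym (smoothing_opposite smJ).
  - exact: color_closed.
  move=> u v uc /orP[/eqP-> | /andP[Ju _]]; first exact: fconnect1.
  by have := Jc u uc; rewrite Ju.
rewrite (n_compC [pred y | b y == true]); apply: leq_add.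
  by apply: sub => // x; rewrite /white => /eqP->.
rewrite (_ : n_comp _ _ = fcard (@face D) [pred y | b y == false]); last first.
  by apply: eq_n_comp_r => y; rewrite !inE; case: (b y).
by apply: sub => // x /eqP->.
Qed.

(** In the plane, a black link and the white link dual to it are never both
    redundant.  From the all-white smoothing to the all-black one, the number of
    black regions falls to one and the number of white regions rises from one.
    Each crossing contributes at most one to the total change, and Euler's
    formula says that it contributes exactly one.  If both links at [x] were
    redundant, a passage from white to black through [flip x J] and [J] would
    lose the contribution of that crossing. *)
Lemma planar_duality J x : smoothing J -> J x -> b x ->
  region (flip x J) x (opposite x) -> ~~ region J (node x) (opposite (node x)).
Proof.
move=> smJ Jx bx black_conn; apply/negP => white_conn.
have smF := flip_smoothing x smJ.
have := n_regions_flip smJ Jx; have := n_regions_flip_dual smJ Jx.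
rewrite bx black_conn white_conn !addn0 /= => w_le b_le.
have := n_regions_chain white_smoothing smF.
have := n_regions_chain smJ black_smoothing.
move=> /(_ (fun _ by_ _ => by_)) chain2.
have w0 y : b y -> white y -> flip x J y by rewrite /white => ->.
move=> /(_ w0) chain1.
have le1 c K : smoothing K -> (forall y, b y == c -> K y) -> n_regions c K <= 1.
  move=> smK Kc; have K_opp := smoothing_opposite smK.
  by apply: n_comp_le1 (region_sym K_opp) (region_connected K_opp Kc).
have b1 : n_regions true b <= 1 by apply: le1 => // y /eqP.
have w1 : n_regions false white <= 1.
  by apply: le1 => // y /eqP; rewrite /white => ->.
have moved : n_moved white J + n_moved J b = #|[pred y | b y]|.
  rewrite -(cardID [pred y | J y] [pred y | b y]) /n_moved; congr (_ + _).
    by apply: eq_card => y; rewrite !inE /white; case: (b y); case: (J y).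
  by apply: eq_card => y; rewrite !inE; case: (b y); case: (J y).
have movedF : n_moved white J = n_moved white (flip x J) + 2.
  by apply: n_moved_flip => //; rewrite /white bx.
have := euler x; have := faces_le_regions; lia.
Qed.

(** * Adequacy *)

(** A bridge forces both arcs onto one circle.  Conversely, such a circle puts
    the two white corners in one region, and by duality the black link is then a
    bridge. *)
Lemma adequate_joined J x : smoothing J -> J x -> b x ->
  ~~ circle J x (opposite x) = region (flip x J) x (opposite x).
Proof.
move=> smJ Jx bx; apply/idP/idP; first by apply: contraNT; apply: bridge_circle.
by move=> /(planar_duality smJ Jx bx); apply: contra; apply: circle_region.
Qed.

(** Here the link is white.  If the black corners are in one region, a black link
    would be redundant, so by duality the white one is a bridge. *)
Lemma adequate_cut J x : smoothing J -> ~~ J x -> b x ->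
  ~~ circle J x (opposite x) = ~~ region J x (opposite x).
Proof.
move=> smJ Jx bx; congr (~~ _); have Jnx : J (node x) by rewrite smJ.
apply/idP/idP => [/(circle_side smJ (b x)) | conn].
  by rewrite /side color_opposite eqxx.
rewrite -circle_opposite_node //; apply: bridge_circle => //.
rewrite [region _ _ _](eq_region (flip_node x J)).
apply: planar_duality => //; first exact: flip_smoothing.
  by rewrite flip_self.
by rewrite [region _ _ _](eq_region (flipK x J)).
Qed.

End Smoothing.

(** * The Tait graph *)

Lemma all_or_none (T : finType) (A B Q : pred T) :
  (forall x y, A x -> B x -> A y -> B y -> Q x = Q y) <->
  (forall x, A x -> B x -> Q x) \/ (forall x, A x -> B x -> ~~ Q x).
Proof.
split=> [same | [all_Q | no_Q] x y Ax Bx Ay By]; last 2 first.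
- by rewrite !all_Q.
- by rewrite (negPf (no_Q x _ _)) // (negPf (no_Q y _ _)).
case: (pickP [pred x | [&& A x, B x & Q x]]) => [x /and3P[Ax Bx Qx] | none].
  by left=> y Ay By; rewrite -(same x y).
by right=> x Ax Bx; have := none x; rewrite /= Ax Bx => /= ->.
Qed.

Section Tait.
Variables (D : link_diagram) (b : coloring D) (s : state D).
Implicit Types (x y : dart D) (u v e f : dart (tait b)).

Definition joined : pred (dart D) := fun x => joins (s x) x.

Let E := E_state b s.

Lemma joined_smoothing : smoothing joined.
Proof.
by move=> x; rewrite /joined res_node /joins; case: (s x); rewrite over_node.
Qed.

Lemma in_E_state e : (e \in E) = joined (val e).
Proof. by rewrite inE /joined /joins; case: (s (val e)). Qed.

Lemma positive_E e :
  e \in E -> positive e = (if s (val e) is Ares then true else false).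
Proof. by rewrite inE; case: (s (val e)) => // /negbTE. Qed.

Lemma positive_notE e :
  e \notin E -> positive e = (if s (val e) is Ares then false else true).
Proof. by rewrite inE; case: (s (val e)) => [/negbTE | /negbNE]. Qed.

Lemma E_edge e : (edge e \in E) = (e \in E).
Proof. by rewrite !in_E_state /= (smoothing_opposite joined_smoothing). Qed.

Lemma component_region (H : {set dart (tait b)}) (K : pred (dart D)) :
  (forall e, K (val e) = (e \in H)) ->
  forall u v, component_in H u v = region K (val u) (val v).
Proof.
move=> KH u v; apply/esym.
exact: (@connect_link_embed _ _ val (@node (tait b)) (@edge (tait b)) (mem H)
         (@face D) (@opposite D) K val_inj).
Qed.

(** The faces of the Tait graph are the white regions; this corner lies in the
    face on the left of [u]. *)
Definition left_corner u : dart D := finv (@node D) (val u).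

Lemma node_left u : node (left_corner u) = val u.
Proof. by rewrite /left_corner f_finv //; apply: node_inj. Qed.

Lemma left_corner_inj : injective left_corner.
Proof. by move=> u v /(finv_inj (@node_inj D)) /val_inj. Qed.

Lemma left_corner_edge u : left_corner (edge u) = opposite (left_corner u).
Proof.
apply: (@node_inj D); rewrite node_left.
by rewrite -[RHS]/(opposite (node (left_corner u))) node_left.
Qed.

Lemma left_corner_face u : left_corner (face u) = face (left_corner u).
Proof.
have /(congr1 (fun v => node (val v))) : node (face u) = edge u.
  by rewrite /face f_finv //; apply: node_inj.
rewrite /= [X in node X = _]/face f_finv; last exact: node_inj.
move=> edge_fu; rewrite {1}/left_corner /face; congr (finv _ _).
apply: (can_inj (@edgeK D)); rewrite edge_fu edgeK /left_corner finv_node //.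
Qed.

Lemma face_region u v :
  face_in E u v = region joined (left_corner u) (left_corner v).
Proof.
apply/esym; apply: connect_link_embed.
- exact: left_corner_inj.
- by move=> e; rewrite left_corner_face.
- by move=> e; rewrite left_corner_edge.
- by move=> e; rewrite in_E_state -node_left joined_smoothing negbK.
Qed.

(** Flipping the crossing of [e] removes its black link, and so deletes [e] from
    [G|E]; the white link that it creates does not affect black corners. *)
Lemma cycle_region e : e \in E ->
  (exists2 c, cycle_in E c & (e \in c) || (edge e \in c)) <->
  region (flip (val e) joined) (val e) (opposite (val e)).
Proof.
move=> eE; apply: (iff_trans (on_cycleP E_edge eE)).
rewrite (component_region (K := flip (val e) joined)) // => u.
have Je : joined (val e) by rewrite -in_E_state.
rewrite !in_setD1 in_E_state /flip crossingE !inE -!val_eqE /=.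
case: (val u =P opposite (val e)) => [u_oe | _] /=.
  by rewrite u_oe (smoothing_opposite joined_smoothing) Je !orbT.
case: (val u =P val e) => [u_e | _] /=; first by rewrite u_e Je.
rewrite (_ : (_ == _) || _ = false) ?addbF //.
by apply/negbTE/negP => /orP[] /eqP u_x; have := valP u;
  rewrite /= u_x ?color_opposite black_node (valP e).
Qed.

Lemma adequateP : diagram_connected D ->
  adequate s <->
  (forall e, e \in E -> exists2 c, cycle_in E c & (e \in c) || (edge e \in c)) /\
  (forall e, e \notin E -> ~~ component_in E e (edge e)).
Proof.
move=> D_conn; have smJ := joined_smoothing.
have compE : forall e, e \notin E ->
    ~~ component_in E e (edge e) = ~~ circle joined (val e) (opposite (val e)).
  move=> e; rewrite in_E_state => eE.
  rewrite (adequate_cut D_conn smJ eE (valP e)).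
  by rewrite (component_region (K := joined)) // => u; rewrite in_E_state.
have cycleE : forall e, e \in E ->
    (exists2 c, cycle_in E c & (e \in c) || (edge e \in c)) <->
    ~~ circle joined (val e) (opposite (val e)).
  move=> e eE; rewrite (adequate_joined D_conn smJ _ (valP e)) -?in_E_state //.
  exact: cycle_region.
split=> [adeq | [cyc comp] x].
  by split=> e eE; [apply/(cycleE _ eE) | rewrite compE //]; apply: adeq.
have black_case y : b y -> ~~ circle joined y (opposite y).
  move=> y_black; pose e : dart (tait b) := Sub y y_black.
  case: (boolP (e \in E)) => eE; first exact/(cycleE _ eE)/cyc.
  by rewrite -[y]/(val e) -compE //; apply: comp.
rewrite -[same_circle _ _ _]/(circle joined x (opposite x)).
case bx: (b x); first exact: black_case.
by rewrite -(circle_opposite_node smJ) black_case // black_node bx.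
Qed.

Lemma homogeneous_res : homogeneous s <->
  forall x y, joined x -> joined y -> region joined x y -> s x = s y.
Proof.
split=> [homog x y jx jy xy | same [x [y [jx jy xy sx sy]]]]; last first.
  by have := same x y jx jy xy; rewrite sx sy.
case sx: (s x); case sy: (s y) => //; case: homog; first by exists x, y.
exists y, x; split=> //; rewrite -[same_state_region _ _ _]/(region joined y x).
by rewrite /region region_sym //; apply: smoothing_opposite joined_smoothing.
Qed.

(** The sign of an edge and its being in [E] determine the resolution of its
    crossing.  The segments in the component of [G|E] of a black corner are its
    edges in [E], and the segments in a white region cross the edges outside [E]
    of the corresponding complementary region. *)
Lemma homogeneousP : homogeneous s <->
  (forall v, (forall e, e \in E -> component_in E v e -> positive e) \/
             (forall e, e \in E -> component_in E v e -> ~~ positive e)) /\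
  (forall f, (forall e, e \notin E -> face_in E f e -> positive e) \/
             (forall e, e \notin E -> face_in E f e -> ~~ positive e)).
Proof.
have reg_sym := region_sym (smoothing_opposite joined_smoothing).
have compE u v : component_in E u v = region joined (val u) (val v).
  by apply: component_region => e; rewrite in_E_state.
have join_left e : joined (left_corner e) = (e \notin E).
  by rewrite in_E_state -node_left joined_smoothing negbK.
have res_left e : s (left_corner e) = s (val e) by rewrite -node_left res_node.
apply: (iff_trans homogeneous_res); split=> [same | [comp face] x y jx jy xy].
  split=> [v | f]; apply/all_or_none => e e' eE e_v eE' e'_v.
    rewrite !positive_E // (same (val e) (val e')) -?in_E_state //.
    move: e_v e'_v; rewrite !compE /region reg_sym; exact: connect_trans.
  rewrite !positive_notE // -!res_left.
  rewrite (same (left_corner e) (left_corner e')) ?join_left //.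
  move: e_v e'_v; rewrite !face_region /region reg_sym; exact: connect_trans.
have pos_eq e e' (t : bool) : (e \in E) = t -> (e' \in E) = t ->
    positive e = positive e' -> s (val e) = s (val e').
  case: t => /[dup] eE; [|move/negbT] => nE /[dup] eE'; [|move/negbT] => nE'.
    by rewrite !positive_E //; do 2!case: (s _).
  by rewrite !positive_notE //; do 2!case: (s _).
case bx: (b x).
  have by_ : b y by rewrite -(region_color b xy).
  pose e : dart (tait b) := Sub x bx; pose e' : dart (tait b) := Sub y by_.
  have eE : e \in E by rewrite in_E_state.
  have eE' : e' \in E by rewrite in_E_state.
  apply: (pos_eq e e' true) => //.
  have /all_or_none same := comp e.
  by apply: same; rewrite // compE //; apply: connect0.
have bnx : b (node x) by rewrite black_node bx.
have bny : b (node y) by rewrite black_node -(region_color b xy) bx.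
pose e : dart (tait b) := Sub (node x) bnx.
pose e' : dart (tait b) := Sub (node y) bny.
have le : left_corner e = x by rewrite /left_corner finv_f //; apply: node_inj.
have le' : left_corner e' = y by rewrite /left_corner finv_f //; apply: node_inj.
have eE : e \notin E by rewrite -join_left le.
have eE' : e' \notin E by rewrite -join_left le'.
rewrite -le -le' !res_left.
apply: (pos_eq e e' false); rewrite ?(negPf eE) ?(negPf eE') //.
have /all_or_none same := face e.
by apply: same; rewrite // face_region ?le ?le' //; apply: connect0.
Qed.

End Tait.

Theorem theorem1p5 (D : link_diagram) (D_connected : diagram_connected D)
    (D_reduced : reduced D) (D_crossing : 0 < n_crossings D)
    (b : coloring D) (o : dart (tait b)) (o_unbounded : tait_unbounded o)
    (s : state D) :
  let E := E_state b s in
  homogeneously_adequate s <->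
  [/\ forall e, e \in E -> exists2 c, cycle_in E c & (e \in c) || (edge e \in c),
      forall e, e \notin E -> ~~ component_in E e (edge e),
      forall v, (forall e, e \in E -> component_in E v e -> positive e) \/
                (forall e, e \in E -> component_in E v e -> ~~ positive e),
      (* the bounded faces of G|E are the insides of the fundamental cycles *)
      forall f, ~~ face_in E o f ->
                (forall e, e \notin E -> face_in E f e -> positive e) \/
                (forall e, e \notin E -> face_in E f e -> ~~ positive e)
    & (forall e, e \notin E -> face_in E o e -> positive e) \/
      (forall e, e \notin E -> face_in E o e -> ~~ positive e)].
Proof.
move=> E; split.
  by case=> /(adequateP b s D_connected)[? ?] /(homogeneousP b)[? face]; split.
case=> cyc comp mono bounded outer.
split; first exact/(adequateP b s D_connected).
apply/(homogeneousP b); split=> // f.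
case: (boolP (face_in E o f)) => [of_ | /bounded //].
have f_o e : face_in E f e -> face_in E o e by apply: connect_trans.
by case: outer => outer; [left | right] => e eE /f_o; apply: outer.
Qed.
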